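(* Let $\mathcal{L}$ be a first-order language, let $\mathcal{M}$ be an $\mathcal{L}$-structure and let $\mathcal{F}\colon \mathcal{L}\mathbf{Str} \to \mathbf{Set}$ be the forgetful functor. Let $f \in \operatorname{Epi}_{\mathcal{F}}(\mathcal{M},-)$, with target $\mathcal{M}/f$. Then the map $\mathcal{M}/\ker f \to \mathcal{M}/f$ defined by $[x]_{\ker f} \mapsto f(x)$, where $x \in M$, is a well-defined isomorphism.
   Context: The universe of an $\mathcal{L}$-structure $\mathcal{M}$ is denoted $M$; constants are $0$-ary function symbols. A strong homomorphism $f\colon \mathcal{M} \to \mathcal{N}$ of $\mathcal{L}$-structures is a map $M \to N$ such that $f(F^{\mathcal{M}}(x_1,\dots,x_n)) = F^{\mathcal{N}}(f(x_1),\dots,f(x_n))$ for every $n$-ary function symbol $F$, and $R^{\mathcal{M}}(x_1,\dots,x_n) \iff R^{\mathcal{N}}(f(x_1),\dots,f(x_n))$ for every $n$-ary relation symbol $R$, for all $x_1,\dots,x_n \in M$. The category $\mathcal{L}\mathbf{Str}$ has $\mathcal{L}$-structures as objects and strong homomorphisms as morphisms; $\mathcal{F}\colon \mathcal{L}\mathbf{Str} \to \mathbf{Set}$ sends a structure to its universe. Isomorphisms in $\mathcal{L}\mathbf{Str}$ are exactly the bijective strong homomorphisms. $\operatorname{Epi}_{\mathcal{F}}(\mathcal{M},-)$ is the class of morphisms $f$ in $\mathcal{L}\mathbf{Str}$ with source $\mathcal{M}$ such that $\mathcal{F}(f)$ is an epimorphism in $\mathbf{Set}$ (i.e. surjective strong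 homomorphisms from $\mathcal{M}$). The target of such an $f$ is denoted $\mathcal{M}/f$. A congruence on $\mathcal{M}$ is an equivalence relation $\theta$ on $M$ such that whenever $(x_i,y_i) \in \theta$ for $1 \le i \leq n$: $(F^{\mathcal{M}}(x_1,\dots,x_n), F^{\mathcal{M}}(y_1,\dots,y_n)) \in \theta$ for every $n$-ary function symbol $F$, and $R^{\mathcal{M}}(x_1,\dots,x_n) \iff R^{\mathcal{M}}(y_1,\dots,y_n)$ for every $n$-ary relation symbol $R$. For a congruence $\theta$ on $\mathcal{M}$, the quotient $\mathcal{M}/\theta$ is the $\mathcal{L}$-structure with universe $M/\theta = \{[x]_\theta \mid x \in M\}$, $F^{\mathcal{M}/\theta}([x_1]_\theta,\dots,[x_n]_\theta) = [F^{\mathcal{M}}(x_1,\dots,x_n)]_\theta$ and $R^{\mathcal{M}/\theta}([x_1]_\theta,\dots,[x_n]_\theta) \iff R^{\mathcal{M}}(x_1,\dots,x_n)$. For a strong homomorphism $f$ with source $\mathcal{M}$, $\ker f = \{\, (x,y) \in M^2 \mid f(x) = f(y) \,\}$, which is a congruence on $\mathcal{M}$. *)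

(* Defs.v *)
From mathcomp Require Import all_boot.
From mathcomp Require Import boolp classical_sets.
From Corelib Require Import RelationClasses.

Set Implicit Arguments.
Unset Strict Implicit.
Unset Printing Implicit Defensive.

Local Open Scope classical_set_scope.

Record language := Language {
  fsymb : Type;
  farity : fsymb -> nat;
  rsymb : Type;
  rarity : rsymb -> nat }.

(* An n-tuple of elements of a universe M is a map 'I_n -> M.  The universe
   may be empty. *)
Record structure (L : language) := Structure {
  universe :> Type;
  fint : forall F : fsymb L, ('I_(farity F) -> universe) -> universe;
  rint : forall P : rsymb L, ('I_(rarity P) -> universe) -> Prop }.

Arguments fint {L} M F x : rename.
Arguments rint {L} M P x : rename.

(* The coercion of a strong homomorphism to its underlying map is the action
   of the forgetful functor from L-structures to sets on morphisms. *)
Record strong_hom (L : language) (M N : structure L) := StrongHom {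
  hom_fun :> M -> N;
  hom_fint : forall (F : fsymb L) (x : 'I_(farity F) -> M),
    hom_fun (fint M F x) = fint N F (fun i => hom_fun (x i));
  hom_rint : forall (P : rsymb L) (x : 'I_(rarity P) -> M),
    rint M P x <-> rint N P (fun i => hom_fun (x i)) }.

(* Isomorphisms in the category of L-structures: morphisms with a two-sided
   inverse morphism.  Parallel morphisms are compared as maps. *)
Definition isomorphism (L : language) (M N : structure L)
    (f : strong_hom M N) : Prop :=
  exists g : strong_hom N M, cancel f g /\ cancel g f.

Definition set_epi (X Y : Type) (f : X -> Y) : Prop :=
  forall (Z : Type) (g h : Y -> Z), g \o f = h \o f -> g = h.

(* The class Epi_F(M, -), each member carrying its target M/f. *)
Record EpiF (L : language) (M : structure L) := MkEpiF {
  target : structure L;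
  epi_hom :> strong_hom M target;
  epi_homP : set_epi epi_hom }.

Record congruence (L : language) (M : structure L) := Congruence {
  cong_rel :> M -> M -> Prop;
  cong_equiv : Equivalence cong_rel;
  cong_fint : forall (F : fsymb L) (x y : 'I_(farity F) -> M),
    (forall i, cong_rel (x i) (y i)) ->
    cong_rel (fint M F x) (fint M F y);
  cong_rint : forall (P : rsymb L) (x y : 'I_(rarity P) -> M),
    (forall i, cong_rel (x i) (y i)) -> (rint M P x <-> rint M P y) }.

Section Quotient.
Variables (L : language) (M : structure L) (theta : congruence M).

Definition quotient_set : Type :=
  {A : set M | exists x : M, A = [set y | theta x y]}.

Definition cong_class (x : M) : quotient_set :=
  exist _ [set y | theta x y] (ex_intro _ x erefl).

Definition class_repr (c : quotient_set) : M := sval (cid (svalP c)).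

(* Interpretations are given on chosen representatives; quotient_fintE and
   quotient_rintE show that the choice does not matter. *)
Definition quotient : structure L := @Structure L quotient_set
  (fun F c => cong_class (fint M F (fun i => class_repr (c i))))
  (fun P c => rint M P (fun i => class_repr (c i))).

Lemma cong_class_eqP (x y : M) : cong_class x = cong_class y <-> theta x y.
Proof.
have [rxx sym trans] := cong_equiv theta; split=> [[exy]|xy].
  have : [set z | theta y z] y by exact: rxx.
  by rewrite -exy.
apply: eq_exist; apply/seteqP; split=> z /= h.
  exact: trans (sym _ _ xy) h.
exact: trans xy h.
Qed.

Lemma class_reprK (c : quotient_set) : cong_class (class_repr c) = c.
Proof.
rewrite /class_repr; case: cid => x /= cx.
by case: c cx => A exA /= cx; apply: eq_exist.
Qed.

Lemma cong_class_repr (x : M) : theta (class_repr (cong_class x)) x.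
Proof. by apply/cong_class_eqP; exact: class_reprK. Qed.

Lemma quotient_fintE (F : fsymb L) (x : 'I_(farity F) -> M) :
  fint quotient F (fun i => cong_class (x i)) = cong_class (fint M F x).
Proof.
by apply/cong_class_eqP/cong_fint => i; exact: cong_class_repr.
Qed.

Lemma quotient_rintE (P : rsymb L) (x : 'I_(rarity P) -> M) :
  rint quotient P (fun i => cong_class (x i)) <-> rint M P x.
Proof. by apply: (@cong_rint _ _ theta) => i; exact: cong_class_repr. Qed.

End Quotient.

Arguments cong_class {L M} theta x.

Section Kernel.
Variables (L : language) (M N : structure L) (f : strong_hom M N).

Definition ker_rel (x y : M) : Prop := f x = f y.

Lemma ker_equiv : Equivalence ker_rel.
Proof.
split=> [x|x y /esym//|x y z]; first by [].
by rewrite /ker_rel => ->.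
Qed.

Lemma ker_fint (F : fsymb L) (x y : 'I_(farity F) -> M) :
  (forall i, ker_rel (x i) (y i)) -> ker_rel (fint M F x) (fint M F y).
Proof.
by move=> xy; rewrite /ker_rel !hom_fint; congr fint; apply/funext.
Qed.

Lemma ker_rint (P : rsymb L) (x y : 'I_(rarity P) -> M) :
  (forall i, ker_rel (x i) (y i)) -> (rint M P x <-> rint M P y).
Proof.
move=> xy; rewrite (hom_rint f x) (hom_rint f y).
by rewrite (_ : (fun i => f (x i)) = fun i => f (y i)) //; apply/funext.
Qed.

Definition ker : congruence M := Congruence ker_equiv ker_fint ker_rint.

End Kernel.

(* Main.v *)
Require Import Defs.
From mathcomp Require Import all_boot.
From mathcomp Require Import boolp.

(** [ker f] identifies exactly the points that [f] identifies, so [f] factors through an injective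
    map on classes, which inherits the strong homomorphism laws from [f]. Epimorphisms of sets are
    surjective, so this map is bijective, and a bijective strong homomorphism has a strong inverse.
    Uniqueness holds because every element of the quotient is a class. *)

(* An epimorphism cannot separate the image predicate from the constant True. *)
Lemma set_epi_surj (X Y : Type) (f : X -> Y) :
  set_epi f -> forall y, exists x, f x = y.
Proof.
move=> epi y.
have /(congr1 (@^~ y)) /= -> // :
  (fun y => exists x, f x = y) = (fun=> True).
apply: epi; apply/funext => x /=; apply/propext; split=> // _.
by exists x.
Qed.

(** Relations pass to the inverse because strong homomorphisms reflect them as well as preserve
    them. *)
Lemma bijective_isomorphism (L : language) (M N : structure L)
  (f : strong_hom M N) : bijective f -> isomorphism f.
Proof.
case=> g fK gK.
have gfint (F : fsymb L) (y : 'I_(farity F) -> N) :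
    g (fint N F y) = fint M F (fun i => g (y i)).
  (* Injectivity of [f] allows comparing the images under [f]. *)
  apply: (can_inj fK); rewrite gK hom_fint; congr fint.
  by apply/funext => i; rewrite gK.
have grint (P : rsymb L) (y : 'I_(rarity P) -> N) :
    rint N P y <-> rint M P (fun i => g (y i)).
  rewrite (hom_rint f).
  by rewrite (_ : (fun i => f (g (y i))) = y) //; apply/funext => i.
by exists (StrongHom gfint grint).
Qed.

Section KernelQuotient.
Variables (L : language) (M N : structure L) (f : strong_hom M N).

Definition ker_map (c : quotient (ker f)) : N := f (class_repr c).

(** Independence of the representative: the one chosen for the class of [x] is [ker f]-related to
    [x], which unfolds to this equality. *)
Lemma ker_map_class (x : M) : ker_map (cong_class (ker f) x) = f x.
Proof. exact: (cong_class_repr (ker f) x). Qed.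

Lemma ker_map_fint (F : fsymb L) (c : 'I_(farity F) -> quotient (ker f)) :
  ker_map (fint (quotient (ker f)) F c) = fint N F (fun i => ker_map (c i)).
Proof. by rewrite ker_map_class hom_fint. Qed.

Lemma ker_map_rint (P : rsymb L) (c : 'I_(rarity P) -> quotient (ker f)) :
  rint (quotient (ker f)) P c <-> rint N P (fun i => ker_map (c i)).
(* Quotient relations are by definition evaluated at representatives, as is [ker_map]. *)
Proof. exact: (hom_rint f). Qed.

Definition ker_hom : strong_hom (quotient (ker f)) N :=
  StrongHom ker_map_fint ker_map_rint.

Lemma ker_hom_inj : injective ker_hom.
Proof.
move=> c d /= fcd.
by rewrite -(class_reprK c) -(class_reprK d); apply/cong_class_eqP.
Qed.

Lemma ker_hom_bij : (forall y, exists x, f x = y) -> bijective ker_hom.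
Proof.
move=> surj; have [g gK] := choice surj.
have hK : cancel (fun y => cong_class (ker f) (g y)) ker_hom.
  by move=> y; rewrite /= ker_map_class gK.
(* A right inverse of an injective map is two-sided. *)
by exists (fun y => cong_class (ker f) (g y)) => // c; apply: ker_hom_inj.
Qed.

End KernelQuotient.

Arguments ker_hom {L M N} f.

(* The unique-map clause expresses that [x] |-> f x is a well-defined map. *)
Theorem proposition3p14 (L : language) (M : structure L) (f : EpiF M) :
  exists phi : strong_hom (quotient (ker f)) (target f),
    unique (fun psi : quotient (ker f) -> target f =>
              forall x : M, psi (cong_class (ker f) x) = f x) phi
    /\ isomorphism phi.
Proof.
exists (ker_hom f); split.
  split=> [x|psi psiE]; first exact: ker_map_class.
  by apply/funext => c; rewrite -(class_reprK c) psiE /= ker_map_class.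
apply/bijective_isomorphism/ker_hom_bij/set_epi_surj; exact: epi_homP.
Qed.
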